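(* If $G$ is a $\{P_5,C_4\}$-free graph, then $G$ is $k$-indicated colorable for all $k\geq\chi(G)$.
   Context: All graphs are finite, simple and undirected. $P_n$ and $C_n$ denote the path and cycle on $n$ vertices; $\chi(G)$ is the chromatic number. A graph is $\mathcal{F}$-free if it has no induced subgraph isomorphic to a member of $\mathcal{F}$. Indicated coloring game on $G$ with a fixed set of $k$ colors: in each round Ann selects an uncolored vertex, and then Ben assigns it one of the $k$ colors not already used on its neighbors (so that the partial coloring stays proper). Ann wins if the whole graph gets properly colored; Ben wins if at some stage there is an uncolored vertex all $k$ colors of which appear on its neighbors. $G$ is $k$-indicated colorable if Ann has a winning strategy (regardless of how Ben plays) with $k$ colors. *)

(* Defs.v *)
From mathcomp Require Import all_boot.
Set Implicit Arguments.
Unset Strict Implicit.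
Unset Printing Implicit Defensive.

Record sgraph := SGraph {
  vertex :> finType;
  edge : rel vertex;
  edge_sym : symmetric edge;
  edge_irr : irreflexive edge
}.

Definition path_edge n : rel 'I_n := fun i j => (i.+1 == j) || (j.+1 == i).

Lemma path_edge_sym n : symmetric (@path_edge n).
Proof. by move=> i j; rewrite /path_edge orbC. Qed.

Lemma path_edge_irr n : irreflexive (@path_edge n).
Proof. by move=> i; rewrite /path_edge orbb eqn_leq ltnn. Qed.

Definition path_graph n := SGraph (@path_edge_sym n) (@path_edge_irr n).

(* The conjunct [i != j] only matters for n = 1, where it removes a loop; the
   cycle C_n is the intended object for 3 <= n. *)
Definition cycle_edge n : rel 'I_n := fun i j =>
  (i != j) && ((i.+1 %% n == j) || (j.+1 %% n == i)).

Lemma cycle_edge_sym n : symmetric (@cycle_edge n).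
Proof. by move=> i j; rewrite /cycle_edge eq_sym orbC. Qed.

Lemma cycle_edge_irr n : irreflexive (@cycle_edge n).
Proof. by move=> i; rewrite /cycle_edge eqxx. Qed.

Definition cycle_graph n := SGraph (@cycle_edge_sym n) (@cycle_edge_irr n).

Definition has_induced (H G : sgraph) : Prop :=
  exists f : H -> G, injective f /\ forall x y, edge (f x) (f y) = edge x y.

Definition is_free (F : sgraph -> Prop) (G : sgraph) : Prop :=
  forall H, F H -> ~ has_induced H G.

Definition proper_coloring (G : sgraph) k (f : G -> 'I_k) : bool :=
  [forall x, forall y, edge x y ==> (f x != f y)].

Definition colorable (G : sgraph) k : bool :=
  [exists f : {ffun G -> 'I_k}, proper_coloring f].

Lemma ex_colorable (G : sgraph) : exists k, colorable G k.
Proof.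
exists #|G|; apply/existsP; exists [ffun x => enum_rank x].
apply/forallP=> x; apply/forallP=> y; apply/implyP=> exy; rewrite !ffunE.
by apply: contraTneq exy => /enum_rank_inj->; rewrite edge_irr.
Qed.

Definition chromatic_number (G : sgraph) : nat := ex_minn (ex_colorable G).

Section IndicatedColoring.
Variables (G : sgraph) (k : nat).

(* A stage of the game is the list of the rounds played so far, latest first:
   (v, a) records that Ann selected v and that Ben then gave v the color a. *)
Definition history := seq (G * 'I_k).

Definition uncolored (h : history) (v : G) : bool := v \notin unzip1 h.

Definition available (h : history) (v : G) (a : 'I_k) : bool :=
  [forall x, edge v x ==> ((x, a) \notin h)].

Definition ann_has_won (h : history) : bool := [forall v, ~~ uncolored h v].

Definition ben_has_won (h : history) : bool :=
  [exists v, uncolored h v && [forall a, ~~ available h v a]].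

(* [None] is needed when no vertex is left to select, in particular when G has
   no vertex at all. *)
Definition strategy := history -> option G.

Inductive play (s : strategy) : history -> Prop :=
| play_start : play s [::]
| play_round h v a :
    play s h -> s h = Some v -> uncolored h v -> available h v a ->
    play s ((v, a) :: h).

(* By [play_size] below every play is finite, so a strategy that always selects
   an uncolored vertex and never lets Ben win ends with all of G colored. *)
Definition winning_strategy (s : strategy) : Prop :=
  forall h, play s h ->
    ~~ ben_has_won h /\
    (ann_has_won h \/ exists v, s h = Some v /\ uncolored h v).

Lemma play_size s h : play s h -> size h <= #|G|.
Proof.
move=> p; have: uniq (unzip1 h).
  by elim: p => //= {}h v a _ IH _ ? _; rewrite IH andbT.
by move/card_uniqP; rewrite size_map => <-; apply: max_card.
Qed.

Definition indicated_colorable : Prop :=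
  exists s : strategy, winning_strategy s.

End IndicatedColoring.

(* Main.v *)
Require Import Defs.
From mathcomp Require Import all_boot zify.

(* A nonempty {P5, C4}-free graph has a simplicial vertex or an induced C5, by
   Dirac's argument on chordal graphs. In the latter case every vertex is
   adjacent to no vertex of the C5, or to all of it, or is a clone of one of its
   vertices. The C5 and its clones thus form a blow-up of C5 by cliques whose
   other neighbors form a clique complete to it. By induction Ann first colors
   everything except the simplicial vertex, respectively the blow-up. The former
   still has a free color; for the latter see [forces_blowup], which only needs
   the clique bounds and that a color is used at most twice on the blow-up. *)

(** The induction runs over vertex sets [W], all of them colored inside the one graph [G]. Whatever
    is removed first is colored last, when Ben has already colored the rest of [W] as he pleased. So
    the proper coloring that the chromatic number provides cannot guide Ann; it serves only to bound
    sizes. This is enough for a blow-up because its colored outer neighbors take the same [a] colors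
    away from each of its vertices, whichever colors Ben gave them. What remains is a blow-up played
    with [#|K| - a] colors.

    The obstacle there is that Ben decides how many colors two nonadjacent cliques 1 and 4 have in
    common. Common colors help clique 0, which is adjacent to both, and hurt the adjacent pair 2 and
    3, one of which sees clique 1 and the other clique 4. Ann's order has to react to this
    number. *)

Set Implicit Arguments.
Unset Strict Implicit.
Unset Printing Implicit Defensive.

(** * The game on partial colorings *)

Section Forcing.
Variables (G : sgraph) (K : finType).

Definition pcoloring := {ffun G -> option K}.
Implicit Types (a : K) (p q : pcoloring) (P Q : pcoloring -> Prop) (X Y : {set G}).

Definition free_color p v a := [forall x, edge v x ==> (p x != Some a)].
Definition assign p v a : pcoloring := [ffun x => if x == v then Some a else p x].
Definition total p := [forall x, p x != None].

(* [a0] is there to make sure that Ben can color [v]. *)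
Inductive forces P : pcoloring -> Prop :=
| forces_now p : P p -> forces P p
| forces_round p v a0 : p v = None -> free_color p v a0 ->
    (forall a, free_color p v a -> forces P (assign p v a)) -> forces P p.

Lemma forces_bind P Q p :
  forces P p -> (forall q, P q -> forces Q q) -> forces Q p.
Proof.
by move=> fP PQ; elim: fP => [q /PQ //|q v a0 qv fa0 _ IH]; apply: forces_round qv fa0 IH.
Qed.

Lemma forces_mono P Q p : forces P p -> (forall q, P q -> Q q) -> forces Q p.
Proof. by move=> fP PQ; apply: forces_bind fP _ => q /PQ; apply: forces_now. Qed.

Definition blank X p := [set x in X | p x == None].

Lemma blank_assign X p v a :
  v \in X -> p v = None -> #|blank X p| = #|blank X (assign p v a)|.+1.
Proof.
move=> vX pv; rewrite (cardsD1 v) inE vX pv eqxx add1n; congr _.+1.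
by apply: eq_card => x; rewrite !inE ffunE; case: (x == v); rewrite ?andbF.
Qed.

Lemma blank_assign_out X p v a :
  v \notin X -> blank X (assign p v a) = blank X p.
Proof.
move=> vX; apply/setP=> x; rewrite !inE ffunE.
by case: (x =P v) => // ->; rewrite (negPf vX).
Qed.

Lemma assign_blank p v a z : p v = None -> p z != None -> assign p v a z = p z.
Proof. by move=> pv; rewrite ffunE; case: (z =P v) => // ->; rewrite pv. Qed.

(* A Boolean form of [forces total], from which the next vertex can be picked;
   [n] bounds the number of rounds left. *)
Fixpoint winning n p :=
  total p || if n is m.+1 then
    [exists v, [&& p v == None, [exists a, free_color p v a] &
      [forall a, free_color p v a ==> winning m (assign p v a)]]]
  else false.

Lemma winningS n p : winning n p -> winning n.+1 p.
Proof.
elim: n p => [|n IH] p /=; first by rewrite orbF => ->.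
case: (total p) => //= /existsP[v /and3P[pv fv /forallP win]].
apply/existsP; exists v; rewrite pv fv; apply/forallP=> a; apply/implyP=> fa.
exact/IH/(implyP (win a)).
Qed.

Lemma forces_winning p n : forces total p -> #|blank setT p| <= n -> winning n p.
Proof.
move=> fp; elim: fp n => {p} [p tp|p v a0 pv fa0 _ IH] n le_n.
  by case: n {le_n} => [|n] /=; rewrite tp.
case: n le_n => [|n]; rewrite (blank_assign a0 (in_setT v) pv) // => le_n.
apply/orP; right; apply/existsP; exists v; rewrite pv eqxx /=.
apply/andP; split; first by apply/existsP; exists a0.
apply/forallP=> a; apply/implyP=> fa; apply: IH fa _ _.
by move: le_n; rewrite -(blank_assign a0 (in_setT v) pv) (blank_assign a (in_setT v) pv).
Qed.

(** Ben wins as soon as any uncolored vertex is blocked, while [winning] inspects only the vertex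
    being presented. But [v] is presented at some point of the continuation, and a color free for it
    then is already free now. *)
Lemma winning_free n p v : winning n p -> p v = None -> exists a, free_color p v a.
Proof.
elim: n p => [|n IH] p /=; have [/forallP/(_ v)/eqP //|_] := boolP (total p) => //=.
case/existsP=> w /and3P[/eqP pw /existsP[b fb] /forallP win] pv.
have [->|v'w] := eqVneq v w; first by exists b.
have [||a /forallP fa] := IH (assign p w b); first exact: (implyP (win b)).
  by rewrite ffunE (negPf v'w).
exists a; apply/forallP=> x; apply/implyP=> vx; move: (implyP (fa x) vx).
by rewrite ffunE; case: (x =P w) => // ->; rewrite pw.
Qed.

(** * Colors seen on a vertex set, and filling such a set *)

Definition nbhd v := [set x : G | edge v x].
Definition clique X := {in X &, forall x y, x != y -> edge x y}.
Definition consistent p := forall x y a, edge x y -> p x = Some a -> p y != Some a.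
Definition filled X p := [forall x in X, p x != None].
Definition used p X : {set K} := [set a | Some a \in p @: X].

Lemma usedP p X a : reflect (exists2 x, x \in X & p x = Some a) (a \in used p X).
Proof. by rewrite inE; apply: (iffP imsetP) => -[x xX px]; exists x. Qed.

Lemma free_colorE p v a : free_color p v a = (a \notin used p (nbhd v)).
Proof.
apply/forallP/idP => [fa|/usedP ua x].
  by apply/usedP => -[x]; rewrite inE => vx px; move: (implyP (fa x) vx); rewrite px eqxx.
by apply/implyP=> vx; apply/eqP=> px; apply: ua; exists x; rewrite ?inE.
Qed.

Lemma exists_free p v : #|used p (nbhd v)| < #|K| -> exists a, free_color p v a.
Proof.
move=> lt_k; have /card_gt0P[a]: 0 < #|~: used p (nbhd v)|.
  by have := cardsC (used p (nbhd v)); lia.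
by rewrite inE -free_colorE; exists a.
Qed.

Lemma used_sub p X Y :
  (forall x, x \in X -> p x != None -> x \in Y) -> used p X \subset used p Y.
Proof.
move=> XY; apply/subsetP=> a /usedP[x xX px]; apply/usedP; exists x => //.
by apply: XY; rewrite ?px.
Qed.

Lemma usedU p X Y : used p (X :|: Y) = used p X :|: used p Y.
Proof. by apply/setP=> a; rewrite !inE imsetU inE. Qed.

Lemma used_eq p q X : {in X, p =1 q} -> used p X = used q X.
Proof. by move=> pq; rewrite /used (eq_in_imset pq). Qed.

Lemma used_blank p X : {in X, forall x, p x = None} -> used p X = set0.
Proof.
by move=> bX; apply/setP=> a; rewrite in_set0; apply/usedP=> -[x /bX->].
Qed.

Lemma used_assign_out p v a X : v \notin X -> used (assign p v a) X = used p X.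
Proof.
by move=> vX; apply: used_eq => x xX; rewrite ffunE; case: eqP vX => // <-; rewrite xX.
Qed.

Lemma used_assign p v a X :
  v \in X -> p v = None -> used (assign p v a) X = a |: used p X.
Proof.
move=> vX pv; apply/setP=> b; rewrite in_setU1; apply/usedP/orP.
  case=> x xX; rewrite ffunE; case: eqP => [_ [->]|_ px]; first by left.
  by right; apply/usedP; exists x.
case=> [/eqP->|/usedP[x xX px]]; first by exists v; rewrite ?ffunE ?eqxx.
by exists x => //; rewrite assign_blank ?px.
Qed.

Lemma some_inj : injective (@Some K).
Proof. by move=> a b []. Qed.

Lemma card_used p X : #|used p X| + #|blank X p| <= #|X|.
Proof.
rewrite -(cardsID [set x | p x == None] X) addnC.
have ->: blank X p = X :&: [set x | p x == None] by apply/setP=> x; rewrite !inE.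
rewrite leq_add2l -(card_imset _ some_inj).
apply: leq_trans (leq_imset_card p _); apply/subset_leq_card/subsetP.
move=> _ /imsetP[a /usedP[x xX px] ->]; rewrite -px.
by apply: imset_f; rewrite !inE px xX.
Qed.

Lemma card_used_clique p X :
  consistent p -> clique X -> filled X p -> #|used p X| = #|X|.
Proof.
move=> pp cX /forall_inP fX; rewrite -(card_imset _ some_inj).
have <-: p @: X = Some @: used p X.
  apply/setP=> o; apply/imsetP/imsetP => [[x xX ->]|[a /usedP[x xX px] ->]].
    case px: (p x) (fX x xX) => [a|] // _; exists a => //.
    by apply/usedP; exists x.
  by exists x.
apply: card_in_imset => x y xX yX pxy; apply/eqP/negPn/negP=> xy.
case px: (p x) (fX x xX) => [a|] // _.
by move: (pp _ _ _ (cX _ _ xX yX xy) px); rewrite -pxy px eqxx.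
Qed.

Definition extends X p q :=
  consistent q /\ forall z, q z = p z \/ z \in X /\ p z = None.

Lemma extends_refl X p : consistent p -> extends X p p.
Proof. by split=> // z; left. Qed.

Lemma extends_assign X p q v a :
  extends X p q -> v \in X -> q v = None -> free_color q v a ->
  extends X p (assign q v a).
Proof.
move=> [pq ext] vX qv /forallP fa; split=> [x y b|z]; last first.
  rewrite ffunE; case: (z =P v) => // ->; right; split=> //.
  by case: (ext v) => [<-|[]].
rewrite !ffunE; case: (x =P v) => [->|_]; case: (y =P v) => [->|_] exy.
- by rewrite edge_irr in exy.
- by case=> <-; apply: (implyP (fa y)).
- move=> qx; apply/eqP=> -[eab]; move: (implyP (fa x)).
  by rewrite edge_sym exy qx eab eqxx => /(_ isT).
- exact: pq.
Qed.

Lemma extends_out X p q z : extends X p q -> z \notin X -> q z = p z.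
Proof. by move=> [_ /(_ z) [//|[->]]]. Qed.

Lemma extends_used X p q Y : extends X p q -> [disjoint Y & X] -> used q Y = used p Y.
Proof.
move=> ext dYX; apply: used_eq => z zY; apply: extends_out ext _.
by rewrite (disjointFr dYX).
Qed.

Lemma extends_used_sub X p q Y : extends X p q -> used p Y \subset used q Y.
Proof.
move=> [_ ext]; apply/subsetP=> a /usedP[x xY px]; apply/usedP; exists x => //.
by case: (ext x) => [->|[_]]; rewrite ?px.
Qed.

Lemma extends_filled X p q Y : extends X p q -> filled Y p -> filled Y q.
Proof.
move=> [_ ext] /forall_inP fY; apply/forall_inP=> z zY.
by case: (ext z) => [->|[_ pz]]; [apply: fY | move: (fY z zY); rewrite pz].
Qed.

Lemma blank_gt0 X p : 0 < #|blank X p| -> exists2 v, v \in X & p v = None.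
Proof. by case/card_gt0P=> v; rewrite inE => /andP[vX /eqP]; exists v. Qed.

Lemma filledE X p : filled X p = (#|blank X p| == 0).
Proof.
rewrite cards_eq0; apply/forall_inP/eqP => [fX|bX x xX].
  by apply/setP=> x; rewrite !inE; apply/andP=> -[/fX/negPf->].
by apply/eqP=> px; move/setP/(_ x): bX; rewrite !inE xX px.
Qed.

(** A loop rule for Ann: she keeps presenting vertices of [X] until [stop] holds, and the number of
    blank vertices of [X] is the variant. [Inv] must survive every reply of Ben. *)
Lemma forces_while X p (Inv : pcoloring -> Prop) (stop : pred pcoloring) :
  (forall q, extends X p q -> Inv q -> ~~ stop q -> exists v,
    [/\ v \in X, q v = None, #|used q (nbhd v)| < #|K|
      & forall a, free_color q v a -> Inv (assign q v a)]) ->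
  consistent p -> Inv p ->
  forces (fun q => [/\ extends X p q, Inv q & stop q]) p.
Proof.
move=> step pp Ip; suff main n q : extends X p q -> Inv q -> #|blank X q| < n ->
    forces (fun q => [/\ extends X p q, Inv q & stop q]) q.
  exact: main (extends_refl X pp) Ip (ltnSn _).
elim: n q => // n IH q ext Iq /ltnSE le_n.
have [sq|nsq] := boolP (stop q); first by apply: forces_now; split.
have [v [vX qv /exists_free[a0 fa0] Inv']] := step q ext Iq nsq.
apply: (forces_round qv fa0) => a fa; apply: IH (Inv' a fa) _; first exact: extends_assign.
by rewrite -(blank_assign a vX qv).
Qed.

(** While [X] has a blank vertex it shows at most [#|X| - 1] colors, so every blank vertex has a
    free color and any order will do. [X] may be partly colored in [p]. *)
Lemma forces_clique X p :
  consistent p -> clique X ->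
  (forall x, x \in X -> #|used p (nbhd x :\: X)| + #|X| <= #|K|) ->
  forces (fun q => extends X p q /\ filled X q) p.
Proof.
move=> pp cX hX.
apply: forces_mono (forces_while (X := X) (Inv := fun=> True) (stop := filled X) _ pp I) _.
  move=> q ext _; rewrite filledE -lt0n => bX; have [v vX qv] := blank_gt0 bX.
  exists v; split=> //; have:= hX v vX; have:= card_used q X.
  have: #|used q (nbhd v)| <= #|used p (nbhd v :\: X)| + #|used q X|.
    rewrite -(extends_used ext); last by rewrite disjoints_subset setDE subsetIr.
    apply: leq_trans (leq_card_setU _ _); rewrite -usedU.
    by apply/subset_leq_card/used_sub => x vx _; rewrite in_setU in_setD vx andbT orNb.
  lia.
by move=> q [].
Qed.

(** A color is lost to [X] and [Y] together only if both lists exclude it or it is already used on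
    them, hence [B1 :&: B2] in the third bound. *)
Definition hall X Y (B1 B2 : {set K}) p :=
  [/\ #|blank X p| + #|B1 :|: used p (X :|: Y)| <= #|K|,
      #|blank Y p| + #|B2 :|: used p (X :|: Y)| <= #|K|
    & #|blank X p| + #|blank Y p| + #|B1 :&: B2 :|: used p (X :|: Y)| <= #|K|].

Lemma hallC X Y B1 B2 p : hall X Y B1 B2 p -> hall Y X B2 B1 p.
Proof.
rewrite /hall (setUC X) [B1 :&: B2]setIC [#|blank X p| + #|blank Y p|]addnC.
by case; split.
Qed.

Lemma cardsU1_le (B : {set K}) a : #|a |: B| <= #|B|.+1.
Proof. by rewrite cardsU1; case: (a \in B). Qed.

(** Coloring [v] lowers the blank count of [X] by one and adds at most one used color, so only the
    bound for [Y] is in danger. If the bound for [X] is tight and [a] is new for [Y],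
    inclusion-exclusion on [B1 :|: C] and [B2 :|: C], whose union misses [a], together with the
    third bound, shows that the bound for [Y] was strict. *)
Lemma hall_assign X Y B1 B2 p v a :
  [disjoint X & Y] -> hall X Y B1 B2 p -> v \in X -> p v = None ->
  a \notin B1 :|: used p (X :|: Y) ->
  [\/ #|blank Y p| = 0, #|blank X p| + #|B1 :|: used p (X :|: Y)| = #|K|
    | #|blank Y p| + #|B2 :|: used p (X :|: Y)| < #|K|] ->
  hall X Y B1 B2 (assign p v a).
Proof.
move=> dXY [h1 h2 h3] vX pv aB1 tight.
have vY : v \notin Y by rewrite (disjointFr dXY).
have eX := blank_assign a vX pv; have eY := blank_assign_out p a vY.
rewrite /hall used_assign ?inE ?vX // eY.
set C := used p _ in h1 h2 h3 aB1 tight *.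
have grow (B : {set K}) : #|B :|: (a |: C)| <= #|B :|: C|.+1.
  by rewrite setUCA cardsU1_le.
have g1 := grow B1; have g2 := grow B2; have g3 := grow (B1 :&: B2).
split; [lia| |lia].
case: tight => [t|t|t]; [|move: t|lia].
  by rewrite t add0n max_card.
have [aBC|aBC] := boolP (a \in B2 :|: C).
  suff ->: B2 :|: (a |: C) = B2 :|: C by [].
  by rewrite setUCA; apply/setUidPr; rewrite sub1set.
have := cardsUI (B1 :|: C) (B2 :|: C); rewrite -setUIl.
have: #|(B1 :|: C) :|: (B2 :|: C)| < #|K|.
  rewrite -cardsT; apply/proper_card/properP.
  by split; [apply: subsetT | exists a; rewrite // in_setU negb_or aB1].
lia.
Qed.

(* The vertices of X must avoid B1 and those of Y must avoid B2, so the three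
   bounds are Hall's condition. Ann keeps it by presenting a vertex of X when
   the bound for X is tight, or when Y is finished, and otherwise one of Y. *)
Lemma forces_two_lists X Y B1 B2 p :
  consistent p -> clique (X :|: Y) -> [disjoint X & Y] ->
  {in X :|: Y, forall x, p x = None} ->
  {in X, forall x, used p (nbhd x :\: (X :|: Y)) = B1} ->
  {in Y, forall x, used p (nbhd x :\: (X :|: Y)) = B2} ->
  #|X| + #|B1| <= #|K| -> #|Y| + #|B2| <= #|K| -> #|X| + #|Y| + #|B1 :&: B2| <= #|K| ->
  forces (fun q => extends (X :|: Y) p q /\ filled (X :|: Y) q) p.
Proof.
move=> pp cXY dXY bXY uX uY h1 h2 h3.
have bl Z q : #|blank Z q| <= #|Z|.
  by apply/subset_leq_card/subsetP=> x; rewrite inE => /andP[].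
have hall0 : hall X Y B1 B2 p.
  rewrite /hall used_blank // !setU0; have := bl X p; have := bl Y p.
  by split; lia.
apply: forces_mono (forces_while (X := X :|: Y) (stop := filled (X :|: Y)) _ pp hall0) _;
  last by move=> q [].
move=> q ext hq; rewrite filledE => nfill.
have usedN v B : v \in X :|: Y -> q v = None -> used p (nbhd v :\: (X :|: Y)) = B ->
    used q (nbhd v) = B :|: used q (X :|: Y).
  move=> vXY qv <-; rewrite -(extends_used ext); last first.
    by rewrite disjoints_subset setDE subsetIr.
  rewrite -usedU; apply/eqP; rewrite eqEsubset; apply/andP; split.
    by apply: used_sub => x vx _; rewrite in_setU in_setD vx andbT orNb.
  apply: used_sub => x; rewrite in_setU in_setD => /orP[/andP[]//|xXY] qx.
  by rewrite inE; apply: cXY => //; apply: contraNneq qx => <-; rewrite qv.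
have bXYE : #|blank (X :|: Y) q| <= #|blank X q| + #|blank Y q|.
  apply: leq_trans (leq_card_setU _ _); apply/subset_leq_card/subsetP=> x.
  by rewrite !inE => /andP[/orP[]->->]; rewrite ?orbT.
set C := used q (X :|: Y) in usedN.
have [g1 g2 g3] := hq; rewrite -/C in g1 g2 g3.
have [/andP[mX tX]|nX] := boolP ((0 < #|blank X q|) &&
    ((#|blank Y q| == 0) || (#|blank X q| + #|B1 :|: C| == #|K|))).
  have [v vX qv] := blank_gt0 mX.
  have vXY : v \in X :|: Y by rewrite inE vX.
  have uN := usedN v B1 vXY qv (uX v vX).
  exists v; split=> // [|a]; first by rewrite uN; lia.
  rewrite free_colorE uN => aB; apply: hall_assign => //.
  by case/orP: tX => /eqP; [apply: Or31 | apply: Or32].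
have mY : 0 < #|blank Y q| by lia.
have [v vY qv] := blank_gt0 mY.
have vXY : v \in X :|: Y by rewrite inE vY orbT.
have uN := usedN v B2 vXY qv (uY v vY).
exists v; split=> // [|a]; first by rewrite uN; lia.
rewrite free_colorE uN => aB; apply/hallC/hall_assign; rewrite ?(setUC Y) //.
- by rewrite disjoint_sym.
- exact: hallC.
- by rewrite -/C; have [->|mX] := posnP #|blank X q|; [apply: Or31 | apply: Or33; lia].
Qed.

(** * Blow-ups of C5 *)

Section PentagonBlowup.
Variables (pos : G -> nat).

Definition at_pos (L : seq nat) := [set x | pos x \in L].
(** Meant for [i < 5]. The guard [j < 5] keeps position 6 apart from position 2, which is
    [7 %% 5]. *)
Definition joined i j :=
  [|| j == 5, j == i, j == i.+1 %% 5 | (j < 5) && (i == j.+1 %% 5)].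

(* Positions 0 to 4 are the five cliques of the blow-up, in cyclic order, and
   position 5 the vertices complete to it; the remaining colored vertices have
   position 6. *)
Definition blowup_stage p0 (D : seq nat) p :=
  [/\ consistent p, forall x, 4 < pos x -> p x = p0 x
    & forall x, pos x < 5 -> pos x \notin D -> p x = None].

Variable p0 : pcoloring.
(** Adjacency to an uncolored vertex outside the blow-up is left open: such vertices lie outside the
    set [W] of the induction. *)
Hypothesis pos_edge : forall x y, pos x < 5 -> (pos y < 5) || (p0 y != None) ->
  edge x y = (x != y) && joined (pos x) (pos y).

Let n i := #|at_pos [:: i]|.
Let a := #|used p0 (at_pos [:: 5])|.

Lemma mem_at_pos x L : (x \in at_pos L) = (pos x \in L).
Proof. by rewrite inE. Qed.

Lemma at_pos_cons i L : at_pos (i :: L) = at_pos [:: i] :|: at_pos L.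
Proof. by apply/setP=> x; rewrite !inE. Qed.

Lemma clique_at_pos i : i < 5 -> clique (at_pos [:: i]).
Proof.
move=> i5 x y; rewrite !mem_at_pos !inE => /eqP px /eqP py xy.
by rewrite pos_edge ?px ?py ?i5 // xy /joined eqxx orbT.
Qed.

Lemma clique_at_pos2 : clique (at_pos [:: 2] :|: at_pos [:: 3]).
Proof.
move=> x y; rewrite !inE => /orP px /orP py xy.
by case: px py => /eqP px [] /eqP py; rewrite pos_edge ?px ?py ?xy.
Qed.

Lemma stage_extends D L p q :
  blowup_stage p0 D p -> all (fun i => i < 5) L -> extends (at_pos L) p q ->
  blowup_stage p0 (L ++ D) q.
Proof.
move=> [pp out bl] /allP L5 ext; split; first by case: ext.
  move=> x x5; rewrite (extends_out ext) ?out //; rewrite mem_at_pos.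
  by apply: contraTN x5 => /L5; rewrite -leqNgt.
move=> x x5; rewrite mem_cat negb_or => /andP[xL xD].
by rewrite (extends_out ext) ?bl // mem_at_pos.
Qed.

Lemma stage_used5 D p :
  blowup_stage p0 D p -> used p (at_pos [:: 5]) = used p0 (at_pos [:: 5]).
Proof.
by case=> _ out _; apply: used_eq => x; rewrite !inE => /eqP px; rewrite out ?px.
Qed.

Lemma used_nbhd L D p x X :
  blowup_stage p0 D p -> pos x < 5 -> [seq j <- D | joined (pos x) j] = L ->
  used p (nbhd x :\: X) \subset used p (at_pos (5 :: L) :\: X).
Proof.
move=> [pp out bl] x5 <-; apply: used_sub => y; rewrite !in_setD mem_at_pos !inE.
case: (y \in X) => //= xy py; rewrite mem_filter.
have [y5|y5] := ltnP (pos y) 5.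
  move: xy; rewrite pos_edge ?y5 // => /andP[_ ->] /=.
  by apply/orP; right; apply: contraNT py => /(bl y y5)->.
move: xy; rewrite pos_edge ?x5 //; last by rewrite -out ?py ?orbT.
move=> /andP[_]; rewrite /joined [pos y < 5]ltnNge y5 orbF => /or3P[->//|/eqP e|/eqP e].
  by move: x5; rewrite -e ltnNge y5.
by have := ltn_pmod (pos x).+1 (isT : 0 < 5); rewrite -e ltnNge y5.
Qed.

Lemma card_used_at i L p :
  #|used p (at_pos (i :: L))| <= #|used p (at_pos [:: i])| + #|used p (at_pos L)|.
Proof. by rewrite at_pos_cons usedU leq_card_setU. Qed.

Lemma used_nil p : used p (at_pos [::]) = set0.
Proof. by apply: used_blank => x; rewrite inE. Qed.

Lemma forces_stage D L i p :
  i < 5 -> blowup_stage p0 D p -> [seq j <- D | joined i j && (j != i)] = L ->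
  a + #|used p (at_pos L)| + n i <= #|K| ->
  forces (fun q => [/\ extends (at_pos [:: i]) p q, blowup_stage p0 (i :: D) q
                     & filled (at_pos [:: i]) q]) p.
Proof.
move=> i5 st eL le_k; have [pp _ _] := st.
have step x : x \in at_pos [:: i] ->
    #|used p (nbhd x :\: at_pos [:: i])| + #|at_pos [:: i]| <= #|K|.
  rewrite mem_at_pos inE => /eqP xi; apply: leq_trans le_k; rewrite leq_add2r.
  rewrite /a -(stage_used5 st); apply: leq_trans (card_used_at _ _ _).
  have x5 : pos x < 5 by rewrite xi.
  apply: leq_trans (subset_leq_card (used_nbhd _ st x5 erefl)) _.
  apply/subset_leq_card/used_sub => y; rewrite in_setD !mem_at_pos !inE -eL xi.
  by rewrite !mem_filter; case: (pos y == i) => //=; rewrite andbT.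
apply: forces_mono (forces_clique pp (clique_at_pos i5) step) _ => q [ext fq].
by split=> //; apply: (stage_extends st _ ext); rewrite /= i5.
Qed.

(** Cliques 2 and 3 form one clique; besides each other and position 5, the first sees only clique 1
    and the second only clique 4. This is [forces_two_lists], where the colors forbidden to both are
    those of position 5 and those shared by cliques 1 and 4. *)
Lemma forces_stage23 D p :
  blowup_stage p0 D p -> 1 \in D -> 4 \in D -> all (mem [:: 0; 1; 4]) D ->
  n 2 + a + #|used p (at_pos [:: 1])| <= #|K| ->
  n 3 + a + #|used p (at_pos [:: 4])| <= #|K| ->
  n 2 + n 3 + a + #|used p (at_pos [:: 1]) :&: used p (at_pos [:: 4])| <= #|K| ->
  forces (fun q => [/\ extends (at_pos [:: 2] :|: at_pos [:: 3]) p q,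
      blowup_stage p0 [:: 2, 3 & D] q & filled (at_pos [:: 2] :|: at_pos [:: 3]) q]) p.
Proof.
move=> st D1 D4 /allP D014 h2 h3 h23; have [pp out bl] := st.
have uN (i j : nat) : (i, j) \in [:: (2, 1); (3, 4)] -> {in at_pos [:: i], forall x,
    used p (nbhd x :\: (at_pos [:: 2] :|: at_pos [:: 3])) = used p (at_pos [:: 5; j])}.
  move=> ij x; rewrite mem_at_pos inE => /eqP xi.
  have x5 : pos x < 5 by rewrite xi; case/orP: ij => [|/orP[]//] /eqP[->].
  apply/eqP; rewrite eqEsubset; apply/andP; split.
    apply: subset_trans (used_nbhd _ st x5 erefl) _; apply: used_sub => y.
    rewrite in_setD in_setU !mem_at_pos !inE xi mem_filter => /andP[ny].
    case/orP=> [->//|/andP[jy /D014]]; rewrite /= !inE => yj.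
    by move: ij jy ny; case/or3P: yj => /eqP-> /orP[|/orP[]//] /eqP[-> ej]; rewrite ?ej.
  apply: used_sub => y; rewrite in_setD in_setU !mem_at_pos !inE => yj py.
  have y0 : (pos y < 5) || (p0 y != None).
    by have [//|y5] := ltnP (pos y) 5; rewrite -out.
  rewrite pos_edge // xi; have [exy|_] := eqVneq x y.
    by move: ij yj; rewrite -exy xi => /orP[|/orP[]//] /eqP[-> ->].
  by move: ij; case/orP: yj => /eqP-> /orP[|/orP[]//] /eqP[-> ej]; rewrite ?ej.
have d23 : [disjoint at_pos [:: 2] & at_pos [:: 3]].
  by apply/pred0P=> x; rewrite /= !inE; case: eqP => // ->.
have b23 : {in at_pos [:: 2] :|: at_pos [:: 3], forall x, p x = None}.
  move=> x; rewrite in_setU !mem_at_pos !inE => /orP x23.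
  by apply: bl; [case: x23 => /eqP-> | apply/negP=> /D014; case: x23 => /eqP->].
have u5 j : used p (at_pos [:: 5; j]) = used p0 (at_pos [:: 5]) :|: used p (at_pos [:: j]).
  by rewrite at_pos_cons usedU (stage_used5 st).
have le5 j : #|used p (at_pos [:: 5; j])| <= a + #|used p (at_pos [:: j])|.
  by rewrite u5 leq_card_setU.
have le5I : #|used p (at_pos [:: 5; 1]) :&: used p (at_pos [:: 5; 4])| <=
    a + #|used p (at_pos [:: 1]) :&: used p (at_pos [:: 4])|.
  by rewrite !u5 -setUIr leq_card_setU.
have := forces_two_lists pp clique_at_pos2 d23 b23 (uN 2 1 isT) (uN 3 4 isT).
have l1 := le5 1; have l4 := le5 4; rewrite -/(n 2) -/(n 3) => f23.
apply: forces_mono (f23 _ _ _) _; try lia.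
move=> q [ext fq]; split=> //; apply: (@stage_extends D [:: 2; 3] _ _ st) => //.
by rewrite at_pos_cons.
Qed.

Lemma disjoint_at j L : j \notin L -> [disjoint at_pos [:: j] & at_pos L].
Proof. by move=> jL; apply/pred0P=> x; rewrite /= !inE; case: eqP => // ->; apply: negPf. Qed.

Definition shared p := #|used p (at_pos [:: 1]) :&: used p (at_pos [:: 4])|.
Definition unshared p := #|used p (at_pos [:: 4]) :\: used p (at_pos [:: 1])|.

(** One more color on clique 4 raises each count by at most one, so both bounds survive if Ann stops
    at the first equality. A free color exists because position 5 is the only other colored
    neighborhood of clique 4 at this stage. *)
Lemma forces_stage4 p :
  blowup_stage p0 [:: 1] p -> a + n 3 + n 4 <= #|K| ->
  n 2 + n 3 + a <= #|K| -> n 0 + n 1 + a <= #|K| ->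
  forces (fun q => [/\ extends (at_pos [:: 4]) p q, blowup_stage p0 [:: 4; 1] q,
      shared q + (n 2 + n 3 + a) <= #|K|, unshared q + (n 0 + n 1 + a) <= #|K|
    & [|| filled (at_pos [:: 4]) q, shared q + (n 2 + n 3 + a) == #|K|
        | unshared q + (n 0 + n 1 + a) == #|K|]]) p.
Proof.
move=> st h34 h23 h01; have [pp _ bl] := st.
have u4 : used p (at_pos [:: 4]) = set0.
  by apply: used_blank => x; rewrite mem_at_pos inE => /eqP x4; apply: bl; rewrite x4.
pose Inv q := shared q + (n 2 + n 3 + a) <= #|K| /\ unshared q + (n 0 + n 1 + a) <= #|K|.
pose stop q := [|| filled (at_pos [:: 4]) q, shared q + (n 2 + n 3 + a) == #|K|
        | unshared q + (n 0 + n 1 + a) == #|K|].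
have Inv0 : Inv p by rewrite /Inv /shared /unshared u4 setI0 set0D cards0.
apply: forces_mono (forces_while (X := at_pos [:: 4]) (stop := stop) _ pp Inv0) _.
  move=> q ext [Iu Iw]; rewrite /stop !negb_or filledE -lt0n => /and3P[b4 nu nw].
  have [v v4 qv] := blank_gt0 b4; exists v; rewrite v4 qv; split=> //.
    have stq := stage_extends (L := [:: 4]) st isT ext.
    move: v4; rewrite mem_at_pos inE => /eqP v4; have v5 : pos v < 5 by rewrite v4.
    have e4 : [seq j <- [:: 4; 1] | joined (pos v) j] = [:: 4] by rewrite v4.
    have := subset_leq_card (used_nbhd set0 stq v5 e4); rewrite !setD0.
    have := card_used_at 5 [:: 4] q; rewrite (stage_used5 stq).
    have := card_used q (at_pos [:: 4]); rewrite -/(n 4) -/a; lia.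
  have v1 : v \notin at_pos [:: 1] by move: v4; rewrite !mem_at_pos !inE => /eqP->.
  move=> b _; rewrite /Inv /shared /unshared (used_assign_out _ _ v1) used_assign //.
  have le1 (B C : {set K}) : #|B :&: (b |: C)| <= #|B :&: C|.+1.
    rewrite setIUr; apply: leq_trans (leq_card_setU _ _) _.
    by rewrite -add1n leq_add2r -(cards1 b) subset_leq_card // subsetIr.
  have := le1 (used q (at_pos [:: 1])) (used q (at_pos [:: 4])).
  have := le1 (~: used q (at_pos [:: 1])) (used q (at_pos [:: 4])).
  rewrite ![~: _ :&: _]setIC -!setDE; move: Iu Iw nu nw; rewrite /shared /unshared.
  by split; lia.
move=> q [ext [Iu Iw] sq]; split=> //.
exact: (stage_extends (L := [:: 4]) st isT ext).
Qed.

(* Ann finishes clique 1 and presents clique 4. The colors of cliques 2 and 3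
   avoid all shared colors, and the colors of clique 0 avoid the unshared ones
   as well, so she stops as soon as one of the two counts is maximal. If there
   are as many shared colors as possible, cliques 2 and 3 come next and clique
   0 comes last; otherwise clique 0 comes next, which makes all remaining
   colors of clique 4 shared, and cliques 2 and 3 come last. *)
Lemma forces_blowup :
  consistent p0 -> (forall x, pos x < 5 -> p0 x = None) ->
  (forall i, i < 5 -> n i + n (i.+1 %% 5) + a <= #|K|) ->
  n 0 + n 1 + n 2 + n 3 + n 4 + a.*2 <= #|K|.*2 ->
  forces (fun q => [/\ consistent q, forall x, 4 < pos x -> q x = p0 x
    & forall x, pos x < 5 -> q x != None]) p0.
Proof.
move=> pp0 bl0 hcl htot.
have h01 : n 0 + n 1 + a <= #|K| := hcl 0 isT.
have h12 : n 1 + n 2 + a <= #|K| := hcl 1 isT.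
have h23 : n 2 + n 3 + a <= #|K| := hcl 2 isT.
have h34 : n 3 + n 4 + a <= #|K| := hcl 3 isT.
have h40 : n 4 + n 0 + a <= #|K| := hcl 4 isT.
have st0 : blowup_stage p0 [::] p0 by split=> // x x5 _; apply: bl0.
have done D q : blowup_stage p0 D q -> (forall i, i < 5 -> filled (at_pos [:: i]) q) ->
    [/\ consistent q, forall x, 4 < pos x -> q x = p0 x & forall x, pos x < 5 -> q x != None].
  move=> [pq out _] fq; split=> // x x5.
  by apply: (forall_inP (fq _ x5)); rewrite mem_at_pos inE.
have cfill i q : i < 5 -> consistent q -> filled (at_pos [:: i]) q ->
    #|used q (at_pos [:: i])| = n i.
  by move=> i5 pq fq; apply: card_used_clique => //; apply: clique_at_pos.
have nil p : #|used p (at_pos [::])| = 0 by rewrite used_nil cards0.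
have same L p q j : extends (at_pos L) p q -> j \notin L ->
    used q (at_pos [:: j]) = used p (at_pos [:: j]).
  by move=> ext jL; apply: extends_used ext (disjoint_at jL).
apply: forces_bind (forces_stage (i := 1) isT st0 erefl _) _ => [|p1 [ext1 st1 f1]].
  by rewrite nil; lia.
have c1 : #|used p1 (at_pos [:: 1])| = n 1 by case: st1 => pp1 _ _; exact: cfill.
apply: forces_bind (forces_stage4 st1 _ _ _) _; try lia.
move=> p2 [ext2 st2 hu hw stop].
have e12 := same _ _ _ 1 ext2 isT.
have [pp2 _ _] := st2.
have UI p : shared p + unshared p = #|used p (at_pos [:: 4])|.
  by rewrite /shared /unshared setIC cardsID.
have UU p : #|used p (at_pos [:: 1; 4])| = #|used p (at_pos [:: 1])| + unshared p.
  by rewrite at_pos_cons usedU -(cardsID (used p (at_pos [:: 1]))) setUK setDUl setDv set0U.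
have swap : at_pos [:: 4; 1] = at_pos [:: 1; 4].
  by apply/setP=> x; rewrite !inE orbC.
have card4 p : #|used p (at_pos [:: 4])| <= n 4.
  by have := card_used p (at_pos [:: 4]); rewrite -/(n 4); lia.
have mono p q : used q (at_pos [:: 1]) = used p (at_pos [:: 1]) ->
    used p (at_pos [:: 4]) \subset used q (at_pos [:: 4]) ->
    shared p <= shared q /\ unshared p <= unshared q.
  by rewrite /shared /unshared => -> s4; rewrite !subset_leq_card ?setIS ?setSD.
have f23 p : filled (at_pos [:: 2] :|: at_pos [:: 3]) p ->
    filled (at_pos [:: 2]) p /\ filled (at_pos [:: 3]) p.
  move=> /forall_inP f; split; apply/forall_inP=> x xi; apply: f; rewrite inE xi ?orbT //.
have [/eqP uk|nuk] := boolP (shared p2 + (n 2 + n 3 + a) == #|K|).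
  apply: forces_bind (forces_stage23 st2 isT isT isT _ _ _) _.
  - by rewrite e12 c1; lia.
  - by have := card4 p2; lia.
  - by rewrite -/(shared p2); lia.
  move=> p3 [ext3 st3 /f23[f2 f3]].
  have c3 : #|used p3 (at_pos [:: 3])| <= n 3.
    by have := card_used p3 (at_pos [:: 3]); rewrite -/(n 3); lia.
  (* Clique 4 may be unfinished. Clique 0 is still blank, so only clique 3 and position 5 restrict
     it. *)
  apply: forces_bind (forces_stage (i := 4) (L := [:: 3]) isT st3 erefl _) _; first by lia.
  move=> p4 [ext4 st4 f4].
  have e23 := at_pos_cons 2 [:: 3]; rewrite -e23 in ext3.
  have [u24 _] : shared p2 <= shared p4 /\ unshared p2 <= unshared p4.
    apply: mono; first by rewrite (same _ _ _ 1 ext4) // (same _ _ _ 1 ext3).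
    exact: subset_trans (extends_used_sub _ ext3) (extends_used_sub _ ext4).
  (* Position 4 occurs twice because clique 4 was entered in two stages. *)
  have c14 : #|used p4 (at_pos [:: 4; 4; 1])| = n 1 + unshared p4.
    have ->: at_pos [:: 4; 4; 1] = at_pos [:: 1; 4].
      by rewrite -swap; apply/setP=> x; rewrite !inE orbA orbb.
    by rewrite UU (same _ _ _ 1 ext4) // (same _ _ _ 1 ext3) // e12 c1.
  have := UI p4; have := card4 p4 => c44 ui4.
  (* Since [shared p4] is at least [#|K| - (n 2 + n 3 + a)], few of the at most [n 4] colors of
     clique 4 are unshared, and the bound on the total leaves room for clique 0. *)
  apply: forces_bind (forces_stage (i := 0) (L := [:: 4; 4; 1]) isT st4 erefl _) _.
    by rewrite c14; lia.
  move=> p5 [ext5 st5 f0]; apply/forces_now/(done _ _ st5).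
  case=> [|[|[|[|[|]]]]] // _; do ?[exact: extends_filled ext5 _].
  - by do 4![apply: extends_filled; first by eassumption].
  - exact: extends_filled ext5 (extends_filled ext4 f2).
  - exact: extends_filled ext5 (extends_filled ext4 f3).
apply: forces_bind (forces_stage (i := 0) (L := [:: 4; 1]) isT st2 erefl _) _.
  by rewrite swap UU e12 c1; lia.
move=> p3 [ext3 st3 f0].
have c0 : #|used p3 (at_pos [:: 0])| <= n 0.
  by have := card_used p3 (at_pos [:: 0]); rewrite -/(n 0); lia.
apply: forces_bind (forces_stage (i := 4) (L := [:: 0]) isT st3 erefl _) _; first by lia.
move=> p4 [ext4 st4 f4].
have e14 : used p4 (at_pos [:: 1]) = used p2 (at_pos [:: 1]).
  by rewrite (same _ _ _ 1 ext4) // (same _ _ _ 1 ext3).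
have [_ w24] : shared p2 <= shared p4 /\ unshared p2 <= unshared p4.
  by apply: mono => //; apply: subset_trans (extends_used_sub _ ext3) (extends_used_sub _ ext4).
(* If clique 4 was already full at [p2], its shared count cannot have grown. If the unshared count
   was maximal, the shared one is at most [n 4] minus that maximum, and the bound on the total
   applies. *)
have hu4 : shared p4 + (n 2 + n 3 + a) <= #|K|.
  have := UI p4; have := UI p2; have := card4 p4.
  case/or3P: stop => [f42|uk|/eqP]; [|by rewrite uk in nuk|lia].
  by rewrite (cfill 4 p2) //; lia.
have := card4 p4 => c44.
apply: forces_bind (forces_stage23 st4 isT isT isT _ _ _) _.
- by rewrite e14 e12 c1; lia.
- lia.
- by rewrite -/(shared p4); lia.
move=> p5 [ext5 st5 /f23[f2 f3]]; apply/forces_now/(done _ _ st5).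
case=> [|[|[|[|[|]]]]] // _.
- exact: extends_filled ext5 (extends_filled ext4 f0).
- by do 4![apply: extends_filled; first by eassumption].
- exact: extends_filled ext5 f4.
Qed.

End PentagonBlowup.

End Forcing.

(** * From forced partial colorings back to strategies on histories *)

Section Game.
Variables (G : sgraph) (k : nat).
Implicit Type h : history G k.

Definition coloring_of h : pcoloring G 'I_k :=
  [ffun x => ohead [seq r.2 | r <- h & r.1 == x]].

Lemma coloring_of_cons h v a : coloring_of ((v, a) :: h) = assign (coloring_of h) v a.
Proof. by apply/ffunP=> x; rewrite !ffunE /= eq_sym; case: eqP. Qed.

Lemma uncoloredE h v : uncolored h v = (coloring_of h v == None).
Proof.
rewrite /uncolored; elim: h => [|[w b] h IH]; first by rewrite ffunE.
by rewrite coloring_of_cons ffunE inE negb_or IH; case: eqP.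
Qed.

Lemma mem_coloring_of h x a :
  uniq (unzip1 h) -> ((x, a) \in h) = (coloring_of h x == Some a).
Proof.
elim: h => [|[w b] h IH]; first by rewrite ffunE.
rewrite coloring_of_cons ffunE inE => /= /andP[wh /IH->].
rewrite xpair_eqE; case: eqP => [->|] //=.
move: wh; rewrite -[_ \notin _]/(uncolored h w) uncoloredE => /eqP->.
by rewrite orbF eq_sym.
Qed.

Lemma availableE h v a :
  uniq (unzip1 h) -> available h v a = free_color (coloring_of h) v a.
Proof. by move=> uh; apply: eq_forallb => x; rewrite mem_coloring_of. Qed.

Lemma forces_indicated_colorable :
  forces (@total G 'I_k) [ffun=> None] -> indicated_colorable G k.
Proof.
move=> /forces_winning win0.
have [n {}win0]: exists n, winning n ([ffun=> None] : pcoloring G 'I_k).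
  by eexists; apply: win0 (leqnn _).
(* The bound [n] stays the same throughout the play, so that the strategy need not count rounds;
   [winningS] restores it after each round. *)
pose good (p : pcoloring G 'I_k) v :=
  (p v == None) && [forall a, free_color p v a ==> winning n (assign p v a)].
pose s : strategy G k := fun h => [pick v | good (coloring_of h) v].
exists s => h hp; have [uh win]: uniq (unzip1 h) /\ winning n (coloring_of h).
  elim: hp => [|{}h v a _ [uh win]].
    by split=> //; congr (winning n _): win0; apply/ffunP=> x; rewrite !ffunE.
  rewrite /s; case: pickP => // w /andP[_ /forallP gw] [<-] uv.
  rewrite availableE // => av; split; first by rewrite /= uh andbT.
  by rewrite coloring_of_cons; apply: (implyP (gw a)).
split.
  apply/existsPn=> v; rewrite negb_and uncoloredE; case: eqP => //= cv.
  have [a fa] := winning_free win cv.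
  by apply/forallPn; exists a; rewrite availableE // fa.
have [/forallP tot|ntot] := boolP (total (coloring_of h)).
  by left; apply/forallP=> v; rewrite uncoloredE tot.
right; rewrite /s; case: pickP => [v /andP[cv _]|no].
  by exists v; rewrite uncoloredE.
move: win no {hp win0 s}; rewrite /good {good}; case: n => [|m] /=;
  rewrite (negPf ntot) //=.
case/existsP=> v /and3P[cv _ /forallP win] /(_ v) /negP[].
rewrite cv; apply/forallP=> a; apply/implyP=> fa.
exact/winningS/(implyP (win a)).
Qed.

End Game.

(** * The structure of {P5, C4}-free graphs *)

Section Structure.
Variable G : sgraph.
Implicit Types (a b c d e v x y z : G) (W : {set G}).

Definition induced_P5 a b c d e :=
  [&& edge a b, edge b c, edge c d, edge d e, ~~ edge a c, ~~ edge a d,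
      ~~ edge a e, ~~ edge b d, ~~ edge b e & ~~ edge c e].
(** Opposite vertices of C4 have the same neighbors, so they must be required to differ. In P5 and
    C5 distinct vertices have distinct neighborhoods, and adjacency alone separates them. *)
Definition induced_C4 a b c d :=
  [&& edge a b, edge b c, edge c d, edge d a, a != c, b != d, ~~ edge a c
    & ~~ edge b d].
Definition induced_C5 a b c d e :=
  [&& edge a b, edge b c, edge c d, edge d e, edge e a, ~~ edge a c,
      ~~ edge a d, ~~ edge b d, ~~ edge b e & ~~ edge c e].

Lemma induced_P5P a b c d e :
  induced_P5 a b c d e -> has_induced (path_graph 5) G.
Proof.
move=> /and5P[ab bc cd de /and5P[ac ad ae bd /andP[be ce]]].
pose f (i : 'I_5) := nth a [:: a; b; c; d; e] i.
have fE (i j : 'I_5) : edge (f i) (f j) = path_edge i j.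
  rewrite /f /path_edge.
  case: i j => [[|[|[|[|[|i]]]]] i5] [[|[|[|[|[|j]]]]] j5] //=;
    rewrite ?edge_irr //; apply/idP/idP => //; rewrite 1?edge_sym //;
    apply/negP => //; rewrite 1?edge_sym //.
exists f; split=> //.
move=> i j fij.
have fx := fE i; have fy := fE j; rewrite fij in fx.
have ij l : path_edge i l = path_edge j l by rewrite -fx -fy.
apply/val_inj.
move: (ij (inord 0)) (ij (inord 1)) (ij (inord 2)) (ij (inord 3)) (ij (inord 4)).
rewrite /path_edge !inordK //.
by case: i {fij fx ij} => [[|[|[|[|[|i]]]]] i5]; case: j {fy} => [[|[|[|[|[|j]]]]] j5].
Qed.

Lemma induced_C4P a b c d :
  induced_C4 a b c d -> has_induced (cycle_graph 4) G.
Proof.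
move=> /and5P[ab bc cd da /and4P[ac bd nac nbd]].
pose f (i : 'I_4) := nth a [:: a; b; c; d] i.
have fE (i j : 'I_4) : edge (f i) (f j) = cycle_edge i j.
  rewrite /f /cycle_edge.
  case: i j => [[|[|[|[|i]]]] i4] [[|[|[|[|j]]]] j4] //=;
    rewrite ?edge_irr //; apply/idP/idP => //; rewrite 1?edge_sym //;
    apply/negP => //; rewrite 1?edge_sym //.
exists f; split=> //.
move=> i j; rewrite /f => fij.
have ne x y : edge x y -> x != y by apply: contraTneq => ->; rewrite edge_irr.
apply/val_inj; move: fij (ne _ _ ab) (ne _ _ bc) (ne _ _ cd) (ne _ _ da) ac bd.
case: i => [[|[|[|[|i]]]] i4]; case: j => [[|[|[|[|j]]]] j4] //= ->; rewrite ?eqxx //.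
Qed.

Hypothesis P5_free : forall a b c d e, ~~ induced_P5 a b c d e.
Hypothesis C4_free : forall a b c d, ~~ induced_C4 a b c d.

Lemma C4_free_common_nbr x y a b :
  edge x a -> edge x b -> edge y a -> edge y b -> x != y -> a != b ->
  ~~ edge x y -> edge a b.
Proof.
move=> xa xb ya yb xy ab nxy; apply: contraNT (C4_free x a y b) => nab.
by rewrite /induced_C4 xa (edge_sym a y) ya yb edge_sym xb xy ab nxy.
Qed.

(* The simplicial vertex is found in a component C of the non-neighbors of v:
   the neighbors S of C outside C all belong to the neighborhood of v and form
   a clique, since two nonadjacent ones would close a cycle through v. *)
Lemma simplicial_non_nbr W v w :
  {in W & &, forall a b c, {in W &, forall d e, ~~ induced_C5 a b c d e}} ->
  v \in W -> w \in W -> w != v -> ~~ edge v w ->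
  exists u, [/\ u \in W, u != v, ~~ edge v u & clique (nbhd u :&: W)].
Proof.
have [n] := ubnP #|W|; elim: n W v w => // n IH W v w /ltnSE leWn C5 vW wW wv vw.
pose R := [set x in W | (x != v) && ~~ edge v x].
pose e' := [rel x y | [&& edge x y, x \in R & y \in R]].
have e'_sym : connect_sym e'.
  by apply: sym_connect_sym => x y; rewrite /= edge_sym [(y \in R) && _]andbC.
have wR : w \in R by rewrite inE wW wv vw.
pose C := [set x in R | connect e' w x].
pose S := [set s in W | edge v s && [exists c in C, edge s c]].
have wC : w \in C by rewrite inE wR connect0.
have CR x : x \in C -> [/\ x \in W, x != v & ~~ edge v x].
  by rewrite !inE => /andP[/and3P[]].
have nbrC x y : x \in C -> y \in W -> edge x y -> y \in C :|: S.
  move=> xC yW xy; have [xW xv vx] := CR x xC; rewrite in_setU.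
  have [vy|vy] := boolP (edge v y).
    by apply/orP; right; rewrite inE yW vy; apply/existsP; exists x; rewrite xC edge_sym.
  have yR : y \in R by rewrite inE yW vy andbT; apply: contraNneq vx => <-; rewrite edge_sym.
  apply/orP; left; rewrite inE yR; move: xC; rewrite inE => /andP[xR wx].
  by apply: connect_trans wx (connect1 _); rewrite /= xy xR yR.
have cS : clique S.
  move=> s t; rewrite !inE => /and3P[sW vs /existsP[a /andP[aC sa]]].
  move=> /and3P[tW vt /existsP[b /andP[bC tb]]] st; apply/negPn/negP=> nst.
  (* Every vertex of [C] is within distance two of [s] through [C]: on a walk from [a], the first
     vertex [y] violating this would end an induced P5 [v], [s], [z], [x], [y]. *)
  pose near y := edge s y || [exists z in C, edge s z && edge z y].
  have near_path p x : x \in C -> near x -> path e' x p -> near (last x p).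
    elim: p x => //= y p IHp x xC sx /andP[/and3P[xy xR yR] ep].
    have yC : y \in C.
      move: xC; rewrite inE => /andP[_ wx]; rewrite inE yR.
      by apply: connect_trans wx (connect1 _); rewrite /= xy xR yR.
    apply: IHp ep => //; rewrite /near; have [//|sy] := boolP (edge s y).
    have [sx'|nsx] := boolP (edge s x).
      by apply/existsP; exists x; rewrite xC sx'.
    move: sx; rewrite /near (negPf nsx) => /existsP[z /and3P[zC sz zx]].
    have [zy|zy] := boolP (edge z y); first by apply/existsP; exists z; rewrite zC sz.
    have := P5_free v s z x y; rewrite /induced_P5 vs sz zx xy nsx sy zy.
    by have [_ _ ->] := CR z zC; have [_ _ ->] := CR x xC; have [_ _ ->] := CR y yC.
  have near_b : near b.
    have : connect e' a b.
      move: aC bC; rewrite !inE => /andP[_ wa] /andP[_ wb].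
      by apply: connect_trans wb; rewrite e'_sym.
    by case/connectP=> p ep ->; apply: near_path ep; rewrite /near ?sa.
  have [bW bv vb] := CR b bC.
  (* Otherwise [v], [s], [c], [t] would be an induced C4. Hence [s] reaches [b] only through some
     [z], and [v], [s], [z], [b], [t] is an induced C5. *)
  have nocommon c : c \in C -> edge s c -> ~~ edge t c.
    move=> cC sc; apply/negP=> tc; have [_ cv vc] := CR c cC.
    move/negP: nst; apply; apply: (@C4_free_common_nbr v c) => //; first by rewrite edge_sym.
    - by rewrite edge_sym.
    - by rewrite eq_sym.
  have sb : ~~ edge s b by apply: contraTN tb => /(nocommon b bC)/negPf->.
  case/orP: near_b; first by rewrite (negPf sb).
  case/existsP=> z /and3P[zC sz zb]; have [zW zv vz] := CR z zC.
  have := C5 v s z vW sW zW b t bW tW.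
  rewrite /induced_C5 vs sz zb (edge_sym b) tb (edge_sym t v) vt vz vb sb nst.
  by rewrite (edge_sym z) nocommon.
have CSW : C :|: S \subset W.
  by apply/subsetP=> x; rewrite in_setU => /orP[/CR[]//|]; rewrite inE => /andP[].
have simplicialC u W' : u \in C -> (forall x, x \in C :|: S -> x \in W') ->
    clique (nbhd u :&: W') -> clique (nbhd u :&: W).
  move=> uC sub cu x y; rewrite !inE => /andP[ux xW] /andP[uy yW].
  by apply: cu; rewrite !inE ?ux ?uy sub ?(nbrC u).
have [/forall_inP univ|/forall_inPn[x0 x0CS]] := boolP [forall x in C :|: S,
    [forall y in C :|: S, (x != y) ==> edge x y]].
  exists w; split=> //; apply: (simplicialC w (C :|: S)) => // x y.
  rewrite !in_setI => /andP[_ xCS] /andP[_ yCS].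
  by move/forall_inP: (univ x xCS) => /(_ y yCS)/implyP.
move/forall_inPn=> [y0 y0CS]; rewrite negb_imply => /andP[xy0 nxy0].
(* The induction on [C :|: S] yields a simplicial vertex among the non-neighbors of [x]. It must
   land in [C], where all neighbors within [W] stay in [C :|: S]. Any [x] in the clique [S] with a
   non-neighbor ensures this; if there is none, no vertex of [S] is a non-neighbor of anything. *)
suff [x [y [xCS yCS xy nxy uC]]] : exists x y, [/\ x \in C :|: S, y \in C :|: S,
    y != x, ~~ edge x y & forall u, u \in C :|: S -> u != x -> ~~ edge x u -> u \in C].
  have [||||||u [uCS ux xu cu]] := IH (C :|: S) x y => //.
  - apply: leq_trans leWn; apply/proper_card/properP; split=> //; exists v => //.
    by apply/negP=> /setUP[/CR[_ /eqP]|] //; rewrite !inE edge_irr andbF.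
  - by move=> a b c /(subsetP CSW) aW /(subsetP CSW) bW /(subsetP CSW) cW d e
      /(subsetP CSW) dW /(subsetP CSW) eW; apply: C5.
  have uC' := uC u uCS ux xu; exists u; have [uW uv vu] := CR u uC'; split=> //.
  exact: simplicialC cu.
have [/existsP[s /andP[sS /existsP[y /and3P[yCS ys sy]]]]|noS] := boolP [exists s in S,
    [exists y in C :|: S, (y != s) && ~~ edge s y]].
  exists s, y; split=> //; first by rewrite inE sS orbT.
  move=> u /setUP[//|uS] us; rewrite cS // eq_sym //.
exists x0, y0; rewrite eq_sym; split=> // u /setUP[//|uS] ux.
case/negP; rewrite edge_sym; apply: contraNT noS => nux.
by apply/existsP; exists u; rewrite uS; apply/existsP; exists x0; rewrite x0CS eq_sym ux.
Qed.

Lemma simplicial_exists W :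
  {in W & &, forall a b c, {in W &, forall d e, ~~ induced_C5 a b c d e}} ->
  W != set0 -> exists2 u, u \in W & clique (nbhd u :&: W).
Proof.
move=> C5 /set0Pn[v vW].
have [/existsP[x /andP[xW /existsP[y /and3P[yW yx xy]]]]|] := boolP [exists x in W,
    [exists y in W, (y != x) && ~~ edge x y]].
  by have [u [uW _ _ cu]] := simplicial_non_nbr C5 xW yW yx xy; exists u.
move=> nex; exists v => // x y; rewrite !inE => /andP[_ xW] /andP[_ yW] xy.
apply: contraNT nex => nxy; apply/existsP; exists x; rewrite xW.
by apply/existsP; exists y; rewrite yW eq_sym xy.
Qed.

(** * Vertices seen from an induced 5-cycle *)

Definition near z x := (z == x) || edge z x.

(* The traces on a 5-cycle of its i-th vertex and of the clones of that vertex
   (i < 5), of a vertex complete to the cycle, and of one with no neighbor. *)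
Definition traces : seq (seq bool) :=
  [:: [:: true; true; false; false; true];
      [:: true; true; true; false; false];
      [:: false; true; true; true; false];
      [:: false; false; true; true; true];
      [:: true; false; false; true; true];
      nseq 5 true; nseq 5 false].

Definition trace a b c d e z :=
  [:: near z a; near z b; near z c; near z d; near z e].

Lemma C5_rot a b c d e : induced_C5 a b c d e -> induced_C5 b c d e a.
Proof.
move=> /and5P[ab bc cd de /and5P[ea ac ad bd /andP[be ce]]].
by rewrite /induced_C5 ab bc cd de ea bd be ce (edge_sym c) ac (edge_sym d) ad.
Qed.

(** For [z] off the cycle, excluding C4 means that two neighbors at distance two on the cycle force
    the vertex between them. This leaves zero to three consecutive neighbors, or all five; excluding
    P5 rules out exactly one, and two consecutive ones. *)
Lemma C5_trace a b c d e z : induced_C5 a b c d e -> trace a b c d e z \in traces.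
Proof.
move=> C5; have := C5.
case/and5P=> ab bc cd de /and5P[ea /negPf ac /negPf ad /negPf bd /andP[/negPf be /negPf ce]].
have E := (ab, bc, cd, de, ea, ac, ad, bd, be, ce, edge_sym b a, edge_sym c b,
  edge_sym d c, edge_sym e d, edge_sym a e, edge_sym c a, edge_sym d a,
  edge_sym d b, edge_sym e b, edge_sym e c).
have ne x y : edge x y || edge y x -> (x == y) = false.
  by case: eqP => // ->; rewrite edge_irr.
have ne2 x y t : edge x t -> edge y t = false -> (x == y) = false.
  by move=> xt yt; apply/eqP=> xy; rewrite -xy xt in yt.
have N : ((a == b) = false) * ((a == c) = false) * ((a == d) = false) * ((a == e) = false)
  * ((b == c) = false) * ((b == d) = false) * ((b == e) = false) * ((c == d) = false)
  * ((c == e) = false) * ((d == e) = false).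
  do !split; try by apply: ne; rewrite !E.
  - by apply: (ne2 _ _ e); rewrite !E.
  - by apply: (ne2 _ _ b); rewrite !E.
  - by apply: (ne2 _ _ a); rewrite !E.
  - by apply: (ne2 _ _ c); rewrite !E.
  - by apply: (ne2 _ _ b); rewrite !E.
have N' := (N, eq_sym b a, eq_sym c a, eq_sym d a, eq_sym e a, eq_sym c b, eq_sym d b,
  eq_sym e b, eq_sym d c, eq_sym e c, eq_sym e d).
rewrite /trace /near.
have [->|za] := eqVneq z a; first by rewrite ?N' ?E.
have [->|zb] := eqVneq z b; first by rewrite ?N' ?E.
have [->|zc] := eqVneq z c; first by rewrite ?N' ?E.
have [->|zd] := eqVneq z d; first by rewrite ?N' ?E.
have [->|ze] := eqVneq z e; first by rewrite ?N' ?E.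
rewrite /=.
have Z := (E, N', edge_sym a z, edge_sym b z, edge_sym c z, edge_sym d z,
  edge_sym e z, negPf za, negPf zb, negPf zc, negPf zd, negPf ze).
move: (C4_free z a b c) (C4_free z b c d) (C4_free z c d e) (C4_free z d e a)
  (C4_free z e a b) (P5_free z a b c d) (P5_free z b c d e) (P5_free z c d e a)
  (P5_free z d e a b) (P5_free z e a b c).
rewrite /induced_C4 /induced_P5 !Z /=.
by case: (edge z a); case: (edge z b); case: (edge z c); case: (edge z d); case: (edge z e).
Qed.

(** Replacing [a] by its clone [x] gives another induced C5. The entries of a trace at [b], [c],
    [d], [e] determine the remaining one, so [y] sees [x] as it sees [a]. *)
Lemma edge_clone a b c d e x y :
  induced_C5 a b c d e -> trace a b c d e x = [:: true; true; false; false; true] ->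
  x != y -> edge x y = near y a.
Proof.
move=> C5 [_ xb xc xd xe] xy.
have C5x : induced_C5 x b c d e.
  case/and5P: (C5) => ab bc cd de /and5P[ea ac ad bd /andP[be ce]].
  move: xc xd; rewrite /near => /negbT; rewrite negb_or => /andP[_ xc].
  move=> /negbT; rewrite negb_or => /andP[_ xd].
  rewrite /induced_C5 bc cd de bd be ce xc xd !andbT.
  apply/andP; split.
    by case/orP: xb => // /eqP xb; rewrite xb bc in xc.
  rewrite edge_sym; case/orP: xe => // /eqP xe; by rewrite xe edge_sym de in xd.
transitivity (near y x); first by rewrite /near eq_sym (negPf xy) edge_sym.
move: (C5_trace y C5) (C5_trace y C5x); rewrite /trace.
by case: (near y a); case: (near y x); case: (near y b); case: (near y c);
  case: (near y d); case: (near y e).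
Qed.

(** The value 6 is both the index of the trace without neighbors and the default outside [W]. *)
Definition position W a b c d e z :=
  if z \in W then index (trace a b c d e z) traces else 6.

Lemma position_edge W a b c d e x y :
  induced_C5 a b c d e -> position W a b c d e x < 5 -> y \in W ->
  edge x y = (x != y) && joined (position W a b c d e x) (position W a b c d e y).
Proof.
move=> C5; rewrite /position; case: ifP => // xW + yW; rewrite yW.
move: (nth_index [::] (C5_trace x C5)) (C5_trace y C5).
move: (index (trace a b c d e x) traces) => i tx ty i5.
have [->|xy] := eqVneq x y; first by rewrite edge_irr.
(* A rotation puts the cycle vertex cloned by [x] first, as [edge_clone] requires. *)
have C5b := C5_rot C5; have C5c := C5_rot C5b; have C5d := C5_rot C5c.
have C5e := C5_rot C5d.
case: i i5 tx => [|[|[|[|[|i]]]]] //= _; case=> xa xb xc xd xe;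
  [ rewrite (edge_clone C5) | rewrite (edge_clone C5b) | rewrite (edge_clone C5c)
  | rewrite (edge_clone C5d) | rewrite (edge_clone C5e) ];
  rewrite ?/trace -?xa -?xb -?xc -?xd -?xe //; move: ty; rewrite /trace;
  by case: (near y a); case: (near y b); case: (near y c); case: (near y d);
  case: (near y e).
Qed.

Lemma C5_ac a b c d e : induced_C5 a b c d e -> a != c.
Proof.
move=> /and5P[_ _ _ _ /and5P[ea _ _ _ /andP[_ ce]]].
by apply: contraNneq ce => <-; rewrite edge_sym.
Qed.

(** Two vertices complete to the cycle are common neighbors of the nonadjacent [a] and [c], so they
    are adjacent by freeness from C4. *)
Lemma position5_clique W a b c d e :
  induced_C5 a b c d e -> clique (at_pos (position W a b c d e) [:: 5]).
Proof.
move=> C5; have ac := C5_ac C5.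
have nac : ~~ edge a c by case/and5P: C5 => _ _ _ _ /and5P[].
have full x : x \in at_pos (position W a b c d e) [:: 5] -> edge a x /\ edge c x.
  rewrite mem_at_pos inE /position; case: ifP => // _ /eqP x5.
  have := nth_index [::] (C5_trace x C5); rewrite x5 /=; case=> xa _ xc _ _.
  split; rewrite edge_sym.
    have := esym xa; rewrite /near => /orP[/eqP xE|//]; rewrite xE in xc.
    by have := esym xc; rewrite /near (negPf ac) (negPf nac).
  have := esym xc; rewrite /near => /orP[/eqP xE|//]; rewrite xE in xa.
  by have := esym xa; rewrite /near eq_sym (negPf ac) edge_sym (negPf nac).
move=> x y /full[ax cx] /full[ay cy] xy.
exact: C4_free_common_nbr ax ay cx cy ac xy nac.
Qed.

Lemma card_at_cons (pos : G -> nat) i j L : i \notin j :: L ->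
  #|at_pos pos [:: i, j & L]| = #|at_pos pos [:: i]| + #|at_pos pos (j :: L)|.
Proof.
move=> iL; rewrite at_pos_cons cardsU; have := disjoint_at pos iL.
by rewrite -setI_eq0 => /eqP->; rewrite cards0 subn0.
Qed.

(** * Size bounds from a proper coloring, and the induction *)

Variables (K : finType) (f : G -> K).
Hypothesis f_proper : forall x y, edge x y -> f x != f y.

Lemma clique_inj (X : {set G}) : clique X -> {in X &, injective f}.
Proof.
move=> cX x y xX yX fxy; apply/eqP/negPn/negP=> xy.
by move: (f_proper (cX x y xX yX xy)); rewrite fxy eqxx.
Qed.

Lemma card_clique (X : {set G}) : clique X -> #|X| <= #|K|.
Proof. by move/clique_inj/card_in_imset => <-; apply: max_card. Qed.

Section Pentagon.
Variables (W : {set G}) (a b c d e : G).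
Hypothesis C5 : induced_C5 a b c d e.
Let pos := position W a b c d e.

Lemma pos_in x : pos x < 6 -> x \in W.
Proof. by rewrite /pos /position; case: ifP. Qed.

Lemma joined_edge x y : pos x < 5 -> pos y < 6 -> x != y ->
  joined (pos x) (pos y) -> edge x y.
Proof. by move=> x5 /pos_in yW xy j; rewrite (position_edge C5 x5 yW) xy j. Qed.

Lemma card_pentagon_clique i : i < 5 ->
  #|at_pos pos [:: i]| + #|at_pos pos [:: i.+1 %% 5]| + #|at_pos pos [:: 5]| <= #|K|.
Proof.
move=> i5; have m5 : i.+1 %% 5 < 5 by rewrite ltn_mod.
have -> : #|at_pos pos [:: i]| + #|at_pos pos [:: i.+1 %% 5]| + #|at_pos pos [:: 5]| =
    #|at_pos pos [:: i; i.+1 %% 5; 5]|.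
  by rewrite !card_at_cons ?addnA //; move: i i5 {m5} => [|[|[|[|[|]]]]].
apply: card_clique => x y; rewrite !mem_at_pos => xi yi xy.
have [x5|x5] := ltnP (pos x) 5.
  apply: joined_edge => //; first by move: yi; rewrite !inE => /or3P[]/eqP->; lia.
  by move: xi yi i5 x5; rewrite !inE => /or3P[]/eqP-> /or3P[]/eqP->;
    case: (i) => [|[|[|[|[|]]]]].
have [y5|y5] := ltnP (pos y) 5.
  rewrite edge_sym; apply: joined_edge; rewrite 1?eq_sym //.
    by move: xi; rewrite !inE => /or3P[]/eqP->; lia.
  by move: xi yi i5 y5; rewrite !inE => /or3P[]/eqP-> /or3P[]/eqP->;
    case: (i) => [|[|[|[|[|]]]]].
apply: (position5_clique (W := W) C5) => //; rewrite mem_at_pos inE.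
  by move: xi x5; rewrite !inE => /or3P[]/eqP; rewrite /pos => ->; lia.
by move: yi y5; rewrite !inE => /or3P[]/eqP; rewrite /pos => ->; lia.
Qed.

(* A color class meets the blow-up in at most two vertices. *)
Lemma card_pentagon :
  #|at_pos pos [:: 0]| + #|at_pos pos [:: 1]| + #|at_pos pos [:: 2]| +
  #|at_pos pos [:: 3]| + #|at_pos pos [:: 4]| + #|at_pos pos [:: 5]|.*2 <= #|K|.*2.
Proof.
pose H := at_pos pos [:: 0; 1; 2; 3; 4]; pose A := at_pos pos [:: 5].
have Hpos x : x \in H -> pos x < 5.
  by rewrite mem_at_pos !inE => /or4P[|||/orP[]] /eqP->.
have cardH : #|H| = #|at_pos pos [:: 0]| + #|at_pos pos [:: 1]| + #|at_pos pos [:: 2]| +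
    #|at_pos pos [:: 3]| + #|at_pos pos [:: 4]|.
  by rewrite /H !card_at_cons // !addnA.
clearbody H.
have leH : #|H| <= #|f @: H|.*2.
  rewrite -sum1_card (partition_big f (fun k => k \in f @: H)) => [|x xH]; last first.
    by rewrite imset_f.
  rewrite -muln2 -sum_nat_const; apply: leq_sum => k _.
  rewrite sum1dep_card leqNgt; apply/card_gt2P=> -[x [y [z [[]]]]].
  rewrite !inE => /andP[/Hpos x5 /eqP fx] /andP[/Hpos y5 /eqP fy] /andP[/Hpos z5 /eqP fz].
  move=> [xy yz zx].
  have nj u v : pos u < 5 -> pos v < 5 -> f u = f v -> u != v -> ~~ joined (pos u) (pos v).
    move=> u5 v5 fuv uv; apply: contraL (eqxx (f u)) => j; rewrite {2}fuv.
    by apply/f_proper/joined_edge => //; apply: ltnW.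
  move: (nj x y x5 y5 (etrans fx (esym fy)) xy) (nj y z y5 z5 (etrans fy (esym fz)) yz)
    (nj z x z5 x5 (etrans fz (esym fx)) zx) (x5) (y5) (z5).
  by case: (pos x) => [|[|[|[|[|?]]]]] //; case: (pos y) => [|[|[|[|[|?]]]]] //;
    case: (pos z) => [|[|[|[|[|?]]]]].
have cA : #|f @: A| = #|A| by apply/card_in_imset/clique_inj/position5_clique.
(* [A] is complete to [H], so their colors are disjoint and [H] carries at most [#|K| - #|A|]
   colors. *)
have : #|f @: H| + #|f @: A| <= #|K|.
  rewrite -cardsUI (_ : f @: H :&: f @: A = set0) ?cards0 ?addn0 ?max_card //.
  apply/setP=> k; rewrite !inE; apply/negP=> /andP[/imsetP[x xH ->] /imsetP[y yA fxy]].
  have x5 := Hpos x xH; move: yA; rewrite mem_at_pos inE => /eqP y5.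
  have xy : x != y by apply: contraTneq x5 => ->; rewrite y5.
  have y6 : pos y < 6 by rewrite y5.
  have j : joined (pos x) (pos y) by rewrite y5.
  by have := f_proper (joined_edge x5 y6 xy j); rewrite fxy eqxx.
rewrite cA -cardH -/A; lia.
Qed.

End Pentagon.

Definition colors_exactly W (p : pcoloring G K) :=
  consistent p /\ forall x, (p x != None) = (x \in W).

Lemma forces_simplicial W u p :
  u \in W -> clique (nbhd u :&: W) -> colors_exactly (W :\ u) p ->
  forces (colors_exactly W) p.
Proof.
move=> uW cu [pp dom]; have pu : p u = None.
  by apply/eqP/negPn; rewrite dom !inE eqxx.
have lt_k : #|used p (nbhd u)| < #|K|.
  have le : #|used p (nbhd u)| <= #|nbhd u :&: W|.
    have := card_used p (nbhd u :&: W); apply: leq_trans.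
    apply: leq_trans (leq_addr _ _); apply/subset_leq_card/used_sub => x ux.
    by rewrite dom !inE => /andP[_ ->]; rewrite inE in ux; rewrite ux.
  apply: leq_ltn_trans le _.
  have: #|u |: (nbhd u :&: W)| <= #|K|.
    apply: card_clique => x y /setU1P[->|xN] /setU1P[->|yN]; rewrite ?eqxx //.
    - by move: yN; rewrite !inE => /andP[].
    - by move: xN; rewrite !inE edge_sym => /andP[].
    - exact: cu.
  by rewrite cardsU1 !inE edge_irr.
have [a0 fa0] := exists_free lt_k.
apply: (forces_round pu fa0) => a fa; apply: forces_now; split.
  by have [] := extends_assign (extends_refl setT pp) (in_setT u) pu fa.
move=> x; rewrite ffunE; have [->|xu] := eqVneq x u; first by rewrite uW.
by rewrite dom !inE xu.
Qed.

(** The vertices complete to the cycle show at most as many colors as there are of them, so the size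
    bounds obtained from [f] hold for Ben's coloring [p]. *)
Lemma forces_pentagon W a b c d e p :
  induced_C5 a b c d e ->
  colors_exactly [set x in W | 4 < position W a b c d e x] p ->
  forces (colors_exactly W) p.
Proof.
move=> C5 [pp dom]; pose pos := position W a b c d e.
have posW x : pos x < 5 -> x \in W by move=> x5; apply: (pos_in (ltnW x5)).
have pe x y : pos x < 5 -> (pos y < 5) || (p y != None) ->
    edge x y = (x != y) && joined (pos x) (pos y).
  move=> x5 y5; apply: position_edge => //; case/orP: y5 => [/posW//|].
  by rewrite dom inE => /andP[].
have bl x : pos x < 5 -> p x = None.
  by move=> x5; apply/eqP/negPn; rewrite dom inE -/(pos x) ltnNge -ltnS x5 andbF.
have le5 : #|used p (at_pos pos [:: 5])| <= #|at_pos pos [:: 5]|.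
  by have := card_used p (at_pos pos [:: 5]); lia.
have hcl i : i < 5 -> #|at_pos pos [:: i]| + #|at_pos pos [:: i.+1 %% 5]| +
    #|used p (at_pos pos [:: 5])| <= #|K|.
  by move=> /(card_pentagon_clique W C5); apply: leq_trans; rewrite leq_add2l.
have htot := card_pentagon W C5; rewrite -/pos in htot.
apply: forces_mono (forces_blowup pe pp bl hcl _) _; first by lia.
move=> q [pq out fill]; split=> // x; have [x5|x5] := ltnP (pos x) 5.
  by rewrite fill // posW.
by rewrite out // dom inE x5 andbT.
Qed.

Lemma forces_colors_exactly W : forces (colors_exactly W) [ffun=> None].
Proof.
have [n] := ubnP #|W|; elim: n W => // n IH W /ltnSE leWn.
have [->|W0] := eqVneq W set0.
  apply: forces_now; split=> [x y k _|x]; first by rewrite ffunE.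
  by rewrite ffunE inE.
have smaller (V : {set G}) x : x \in W -> x \notin V -> V \subset W -> #|V| < n.
  move=> xW xV VW; apply: leq_trans leWn; apply/proper_card/properP.
  by split=> //; exists x.
case: (pickP (fun r : G * G * G * G * G => let: (a, b, c, d, e) := r in
    [&& a \in W, b \in W, c \in W, d \in W, e \in W & induced_C5 a b c d e])).
  case=> [[[[a b] c] d] e] /and5P[aW _ _ _ /andP[_ C5]].
  apply: forces_bind (IH _ _) (fun p => @forces_pentagon W a b c d e p C5).
  (* The trace of [a] is true at [a] and false at [c], hence neither constant trace; its position is
     below 5 and the set shrinks. *)
  apply: (smaller _ a) => //; last by apply/subsetP=> x; rewrite inE => /andP[].
  have nac : edge a c = false by case/and5P: C5 => _ _ _ _ /and5P[_ /negPf].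
  have naa : near a a by rewrite /near eqxx.
  have nc : near a c = false by rewrite /near (negPf (C5_ac C5)).
  rewrite inE aW /position aW; move: (C5_trace a C5); rewrite /trace naa nc.
  by case: (near a b); case: (near a d); case: (near a e).
move=> noC5.
have C5W : {in W & &, forall a b c, {in W &, forall d e, ~~ induced_C5 a b c d e}}.
  move=> a b c aW bW cW d e dW eW; apply/negP=> C5.
  by have := noC5 (a, b, c, d, e); rewrite aW bW cW dW eW C5.
have [u uW cu] := simplicial_exists C5W W0.
apply: forces_bind (IH (W :\ u) _) _.
  by apply: (smaller _ u) => //; rewrite ?subD1set // !inE eqxx.
by move=> p; apply: forces_simplicial.
Qed.

End Structure.

Theorem corollary3p8 (G : sgraph)
  (G_free : is_free (fun H => H = path_graph 5 \/ H = cycle_graph 4) G)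
  (k : nat) (k_ge : chromatic_number G <= k) :
  indicated_colorable G k.
Proof.
have P5_free a b c d e : ~~ @induced_P5 G a b c d e.
  by apply/negP=> /induced_P5P; apply: G_free; left.
have C4_free a b c d : ~~ @induced_C4 G a b c d.
  by apply/negP=> /induced_C4P; apply: G_free; right.
move: k_ge; rewrite /chromatic_number; case: ex_minnP => n + _ le_nk.
case/existsP=> f /forallP f_proper.
have g_proper x y : edge x y -> widen_ord le_nk (f x) != widen_ord le_nk (f y).
  by move=> xy; move/forallP: (f_proper x) => /(_ y)/implyP/(_ xy).
apply: forces_indicated_colorable.
apply: forces_mono (forces_colors_exactly P5_free C4_free g_proper setT) _.
by move=> p [_ dom]; apply/forallP=> x; rewrite dom inE.
Qed.
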